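(* Let $n\in\mathbb{Z}_{\ge 1}$ and let $q\in\mathbb{R}$ with $0<q<\lfloor n/2\rfloor$ and fractional part $\widehat q := q-\lfloor q\rfloor\neq 0$. If $\widehat q\in(0,2^{-n}]$, then the SOS rank of the unweighted minimum knapsack instance $\mathrm{MK}(q)$ on $n$ variables is $\Theta(n)$, with absolute implied constants.
   Context: For $\mathbf{x}\in\{0,1\}^n$ write $|\mathbf{x}|=\sum_{i=1}^n x_i$. The instance $\mathrm{MK}(q)$ is the problem of minimizing $|\mathbf{x}|$ subject to $|\mathbf{x}|\ge q$, $\mathbf{x}\in\{0,1\}^n$; for $0\le q\le n$ its optimal value is $\lceil q\rceil$. A polynomial in $\mathbb{R}[x_1,\dots,x_n]$ is SOS if it is a finite sum of squares of real polynomials. For $0\le q\le n$, a degree-$d$ SOS certificate of optimality for $\mathrm{MK}(q)$ consists of SOS polynomials $s_0,s_1\in\mathbb{R}[x_1,\dots,x_n]$ with $\deg(s_0)\le 2d+2$, $\deg(s_1)\le 2d$ and $$|\mathbf{x}|-\lceil q\rceil = s_0(\mathbf{x})+s_1(\mathbf{x})(|\mathbf{x}|-q)\quad\text{for all }\mathbf{x}\in\{0,1\}^n.$$ The SOS rank of $\mathrm{MK}(q)$ is the smallest $d\in\mathbb{Z}_{\ge 0}$ for which such a certificate exists. *)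

(* Defs.v *)
From HB Require Import structures.
From mathcomp Require Import all_boot all_order all_algebra.
From mathcomp Require Import reals.
From mathcomp Require Import mpoly.

Set Implicit Arguments.
Unset Strict Implicit.
Unset Printing Implicit Defensive.

Import Order.TTheory GRing.Theory Num.Theory.
Local Open Scope ring_scope.

Definition is_sos (R : realType) (n : nat) (p : {mpoly R[n]}) : Prop :=
  exists s : seq {mpoly R[n]}, p = \sum_(g <- s) g ^+ 2.

(* [msize p] is one more than the total degree of [p], and [msize 0 = 0]. *)
Definition mdeg_le (R : realType) (n : nat) (p : {mpoly R[n]}) (k : nat) : bool :=
  (msize p <= k.+1)%N.

(* Points of the hypercube {0,1}^n are Boolean functions on 'I_n. *)
Definition cube_pt (R : realType) (n : nat) (x : {ffun 'I_n -> bool}) : 'I_n -> R :=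
  fun i => (x i)%:R.

Definition cube_weight (R : realType) (n : nat) (x : {ffun 'I_n -> bool}) : R :=
  \sum_(i < n) cube_pt R x i.

Definition MK_sos_certificate (R : realType) (n : nat) (q : R) (d : nat)
    (s0 s1 : {mpoly R[n]}) : Prop :=
  [/\ is_sos s0, is_sos s1, mdeg_le s0 (2 * d + 2)%N, mdeg_le s1 (2 * d)%N &
      forall x : {ffun 'I_n -> bool},
        cube_weight R x - (Num.ceil q)%:~R
        = s0.@[cube_pt R x] + s1.@[cube_pt R x] * (cube_weight R x - q)].

Definition MK_has_certificate (R : realType) (n : nat) (q : R) (d : nat) : Prop :=
  exists s0 s1 : {mpoly R[n]}, MK_sos_certificate q d s0 s1.

(* [MK_sos_rank n q d]: the rank of MK(q) on n variables is defined and equals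
   d, i.e. d is the least degree of a certificate. *)
Definition MK_sos_rank (R : realType) (n : nat) (q : R) (d : nat) : Prop :=
  MK_has_certificate n q d /\
  forall d' : nat, MK_has_certificate n q d' -> (d <= d')%N.

Definition frac_part (R : realType) (q : R) : R := q - (Num.floor q)%:~R.

(* Main.v *)
Require Import Defs.
From HB Require Import structures.
From mathcomp Require Import all_boot all_order all_algebra.
From mathcomp Require Import reals.
From mathcomp Require Import mpoly.
From mathcomp Require Import boolp zify ring lra.

Set Implicit Arguments.
Unset Strict Implicit.
Unset Printing Implicit Defensive.

Import Order.TTheory GRing.Theory Num.Theory.
Local Open Scope ring_scope.

(** Upper bound: every function on the cube is the restriction of a
    multilinear polynomial, so degree n always suffices.

    Lower bound: let k = floor q and let (s0, s1) be a degree-d certificate.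
    The certificate identity forces s1 >= 1 / (q - k) >= 2^n at points of
    weight k, and 0 <= s1 <= 1 at points of weight > k.  If 2d < n - k, then
    the alternating sum of s1 over all points above a fixed point of weight k
    vanishes; this writes a number >= 2^n as a signed sum of at most 2^n - 1
    numbers in [0, 1], which is absurd.  Hence 2d >= n - k >= n / 2. *)

Lemma mdeg_leM (R : realType) n (p r : {mpoly R[n]}) a b :
  mdeg_le p a -> mdeg_le r b -> mdeg_le (p * r) (a + b).
Proof.
rewrite /mdeg_le => pa rb.
have [->|p0] := eqVneq p 0; first by rewrite mul0r msize0.
have [->|r0] := eqVneq r 0; first by rewrite mulr0 msize0.
rewrite msizeM //; move: (msize p) (msize r) pa rb => u v; lia.
Qed.

Lemma mdeg_le_prod (R : realType) n (I : Type) (s : seq I)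
    (F : I -> {mpoly R[n]}) :
  (forall i, mdeg_le (F i) 1) -> mdeg_le (\prod_(i <- s) F i) (size s).
Proof.
move=> F1; elim: s => [|i s IH] /=.
  by rewrite big_nil /mdeg_le -mpolyC1 msizeC; case: (_ != _).
by rewrite big_cons -add1n; exact: mdeg_leM.
Qed.

(** Lagrange interpolation: on the cube, [\prod_i L f i] is the indicator of the point [f], and it
    is a product of n affine factors. *)
Lemma cube_interpolation (R : realType) n (g : {ffun 'I_n -> bool} -> R) :
  exists2 p : {mpoly R[n]}, mdeg_le p n & forall x, p.@[cube_pt R x] = g x.
Proof.
pose L (f : {ffun 'I_n -> bool}) (i : 'I_n) : {mpoly R[n]} :=
  if f i then 'X_i else 1 - 'X_i.
have LE f x i : (L f i).@[cube_pt R x] = (f i == x i)%:R.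
  rewrite /L /cube_pt; case: (f i); rewrite ?mevalB ?meval1 mevalXU.
    by case: (x i).
  by case: (x i); rewrite ?subrr ?subr0.
exists (\sum_f g f *: \prod_i L f i) => [|x].
  rewrite /mdeg_le; apply: leq_trans (msize_sum _ _ _) _.
  apply/bigmax_leqP => f _; apply: leq_trans (msizeZ_le _ _) _.
  rewrite -[X in (_ <= X.+1)%N](size_enum_ord n) -big_enum.
  apply: mdeg_le_prod => i; rewrite /mdeg_le /L.
  have X2 : (msize ('X_i : {mpoly R[n]}) <= 2)%N by rewrite msizeX mdeg1.
  case: (f i) => //; apply: leq_trans (msizeD_le _ _) _.
  by rewrite msizeN geq_max X2 -mpolyC1 msizeC; case: (_ != _).
rewrite raddf_sum /= (bigD1 x) //= mevalZ rmorph_prod /=.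
rewrite big1 ?mulr1 => [|i _]; last by rewrite LE eqxx.
rewrite big1 ?addr0 // => f fx; rewrite mevalZ rmorph_prod /=.
have [i fi] : exists i, f i != x i.
  apply/existsP; rewrite -negb_forall; apply: contra fx => /forallP fx.
  by apply/eqP/ffunP => i; exact/eqP.
by rewrite (bigD1 i) //= LE (negbTE fi) mul0r mulr0.
Qed.

(* Weights, up to sign, of the iterated finite difference in the directions
   [i >= k] at the point with ones exactly at [i < k]. *)
Definition alt_sign (R : realType) n k (f : {ffun 'I_n -> bool}) : R :=
  \prod_(i < n) (if (i < k)%N then (f i)%:R else (-1) ^+ f i).

(** A monomial of degree below n - k misses some variable j >= k. Flipping coordinate j preserves
    its value and negates the sign, so the terms cancel in pairs. *)
Lemma alt_sign_sum0 (R : realType) n k (p : {mpoly R[n]}) :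
  (k <= n)%N -> (msize p <= n - k)%N ->
  \sum_f alt_sign R k f * p.@[cube_pt R f] = 0.
Proof.
move=> kn szp.
under eq_bigr do rewrite mevalE mulr_sumr.
rewrite exchange_big /= big_seq big1 // => m /msize_mdeg_lt mp.
under eq_bigr do rewrite mulrCA.
rewrite -mulr_sumr; apply/eqP; rewrite mulf_eq0; apply/orP; right; apply/eqP.
have [j kj mj] : exists2 j : 'I_n, (k <= j)%N & m j = 0%N.
  have : [exists j : 'I_n, (k <= j)%N && (m j == 0%N)].
    apply: contraLR (leq_trans mp szp) => /existsPn H.
    rewrite -leqNgt mdegE.
    (* If all n - k variables with index >= k occurred, the degree would be at least n - k. *)
    apply: (@leq_trans (\sum_(i < n) (k <= i))); last first.
      by apply: leq_sum => i _; have := H i; case: (k <= i)%N; case: (m i).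
    elim: n {p szp m mp H} kn => [|n IH] kn; first by rewrite sub0n.
    rewrite big_ord_recr /=.
    have [kn'|] := leqP k n; last by lia.
    by rewrite subSn // addn1 ltnS; exact: IH.
  by case/existsP => j /andP[? /eqP ?]; exists j.
pose F (i : 'I_n) (b : bool) : R :=
  (if (i < k)%N then b%:R else (-1) ^+ b) * b%:R ^+ m i.
transitivity (\sum_(f : {ffun 'I_n -> bool}) \prod_i F i (f i)).
  by apply: eq_bigr => f _; rewrite -big_split.
(* The sum factors over coordinates; since 0 ^ 0 = 1, the factor at [j] is -1 + 1. *)
rewrite -bigA_distr_bigA (bigD1 j) //= big_bool /F ltnNge kj mj /=.
by rewrite !expr0 !mulr1 expr1 addNr mul0r.
Qed.

Lemma alt_sign_norm_le1 (R : realType) n k (f : {ffun 'I_n -> bool}) :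
  `|alt_sign R k f| <= 1.
Proof.
rewrite normr_prod; apply: prodr_ile1 => i _; rewrite normr_ge0 /=.
case: ifP => _; last by rewrite normrX normrN1 expr1n.
by case: (f i); rewrite ?normr1 ?normr0.
Qed.

Definition low_pt n k : {ffun 'I_n -> bool} := [ffun i : 'I_n => (i < k)%N].

Lemma alt_sign_low (R : realType) n k : alt_sign R k (low_pt n k) = 1.
Proof. by rewrite /alt_sign big1 // => i _; rewrite ffunE; case: (_ < _)%N. Qed.

Lemma weight_low n k : (k <= n)%N -> (\sum_i low_pt n k i)%N = k.
Proof.
move=> kn; under eq_bigr do rewrite ffunE.
(* The form with [minn] is valid for every n, which lets the induction run without k <= n. *)
suff -> : (\sum_(i < n) (i < k))%N = minn k n by apply/minn_idPl.
elim: n {kn} => [|n IH]; first by rewrite big_ord0 minn0.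
by rewrite big_ord_recr /= IH; case: ltnP => /=; lia.
Qed.

(** A nonzero sign forces [f i] to be true for all i < k, so [f] dominates [low_pt n k]
    pointwise. *)
Lemma alt_sign_neq0 (R : realType) n k (f : {ffun 'I_n -> bool}) :
  (k <= n)%N -> f != low_pt n k -> alt_sign R k f != 0 ->
  (k < \sum_i f i)%N.
Proof.
move=> kn fx /prodf_neq0 w0.
have lf i : (low_pt n k i <= f i)%N.
  rewrite ffunE; have := w0 i isT; case: ifP => // _.
  by case: (f i); rewrite ?eqxx.
have [j fj] : exists j, f j != low_pt n k j.
  apply/existsP; rewrite -negb_forall; apply: contra fx => /forallP fx.
  by apply/eqP/ffunP => i; exact/eqP.
rewrite -[X in (X < _)%N](weight_low kn) (bigD1 j) //= [ltnRHS](bigD1 j) //=.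
rewrite -addSn leq_add ?leq_sum // ltn_neqAle lf andbT eq_sym.
by move: fj; case: (f j); case: (low_pt n k j).
Qed.

Lemma cube_weightE (R : realType) n (x : {ffun 'I_n -> bool}) :
  cube_weight R x = (\sum_i x i)%N%:R.
Proof. by rewrite /cube_weight natr_sum. Qed.

Lemma sos_ge0 (R : realType) n (p : {mpoly R[n]}) v : is_sos p -> 0 <= p.@[v].
Proof.
case=> s ->; rewrite raddf_sum /=; apply: sumr_ge0 => g _.
by rewrite rmorphXn /= sqr_ge0.
Qed.

Lemma is_sos_sqr (R : realType) n (p : {mpoly R[n]}) : is_sos (p * p).
Proof. by exists [:: p]; rewrite big_seq1 expr2. Qed.

Lemma floor_split (R : realType) (q : R) : 0 < q -> 0 < frac_part q ->
  exists k : nat, q = k%:R + frac_part q /\ Num.ceil q = k.+1 :> int.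
Proof.
move=> q0 fq0; have fl0 : 0 <= Num.floor q by rewrite floor_ge0 ltW.
have kE : (`|Num.floor q|%N%:R : R) = (Num.floor q)%:~R.
  by rewrite pmulrn gez0_abs.
exists `|Num.floor q|%N; split; first by rewrite kE /frac_part; ring.
apply: ceil_def; have := ltW (floorD1_gt q); move: fq0; rewrite /frac_part.
rewrite -addn1 PoszD gez0_abs // addrK => fq0 -> ; rewrite andbT; lra.
Qed.

Lemma MK_has_certificate_n (R : realType) n (q : R) :
  0 < q -> 0 < frac_part q -> MK_has_certificate n q n.
Proof.
move=> q0 fq0; have [k [qE cE]] := floor_split q0 fq0.
have fq1 : q <= k.+1%:R by have /andP[_] := ceil_itv q; rewrite cE.
pose w x := cube_weight R (n := n) x.
(* Split at weight k: up to k take s0 = 0 and solve the identity for s1; above k take s1 = 0. Both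
   values are nonnegative, so interpolating their square roots and squaring gives SOS
   polynomials. *)
have [p0 p0d p0E] := cube_interpolation
  (fun x => Num.sqrt (if w x <= k%:R then 0 else w x - k.+1%:R)).
have [p1 p1d p1E] := cube_interpolation
  (fun x => Num.sqrt (if w x <= k%:R then (k.+1%:R - w x) / (q - w x) else 0)).
exists (p0 * p0), (p1 * p1); split; try exact: is_sos_sqr.
- by have := mdeg_leM p0d p0d; rewrite /mdeg_le; lia.
- by have := mdeg_leM p1d p1d; rewrite /mdeg_le; lia.
move=> x; rewrite cE !rmorphM /= p0E p1E -!expr2 -/(w x) -pmulrn.
case: ifPn => wk.
  have wq : 0 < q - w x by rewrite qE; lra.
  rewrite !sqr_sqrtr //.
    by field; rewrite gt_eqF.
  by rewrite divr_ge0 ?ltW //; move: wk; rewrite -natr1; lra.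
rewrite !sqr_sqrtr // ?mul0r ?addr0 //.
by move: wk; rewrite subr_ge0 /w cube_weightE !ler_nat -ltnNge.
Qed.

Section Multiplier.
Variables (R : realType) (n k d : nat) (q : R) (s0 s1 : {mpoly R[n]}).
Hypothesis fq0 : 0 < frac_part q.
Hypotheses (qE : q = k%:R + frac_part q) (cE : Num.ceil q = k.+1 :> int).
Hypothesis cert : MK_sos_certificate q d s0 s1.

(** At weight k the identity reads -1 = s0 - s1 * [frac_part q], with s0 >= 0. *)
Lemma multiplier_low (x : {ffun 'I_n -> bool}) :
  (\sum_i x i)%N = k -> (frac_part q)^-1 <= s1.@[cube_pt R x].
Proof.
move=> wx; have [sos0 _ _ _ /(_ x)] := cert.
have := sos_ge0 (cube_pt R x) sos0.
rewrite cE cube_weightE wx [in X in _ * X]qE -pmulrn -natr1 => s00 H.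
by rewrite -[_^-1]mul1r ler_pdivrMr //; lra.
Qed.

(** At weight w > k, s1 * (w - q) <= w - (k + 1) <= w - q, and w - q is positive. *)
Lemma multiplier_high (x : {ffun 'I_n -> bool}) :
  (k < \sum_i x i)%N -> frac_part q <= 1 / 2 -> s1.@[cube_pt R x] <= 1.
Proof.
move=> wx fq1; have [sos0 _ _ _ /(_ x)] := cert.
have := sos_ge0 (cube_pt R x) sos0.
rewrite cE cube_weightE [in X in _ * X]qE -pmulrn -natr1.
move: wx; rewrite -(ler_nat R) -natr1.
set w := (\sum_i x i)%N%:R => wx s00 H.
have wq : 0 < w - (k%:R + frac_part q) by lra.
by rewrite -(ler_pM2r wq) mul1r; lra.
Qed.

End Multiplier.

Lemma certificate_degree (R : realType) n k (q : R) d :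
  (1 <= n)%N -> (k <= n)%N -> 0 < frac_part q -> frac_part q <= 2%:R ^- n ->
  q = k%:R + frac_part q -> Num.ceil q = k.+1 :> int ->
  MK_has_certificate n q d -> (n - k <= 2 * d)%N.
Proof.
move=> n1 kn fq0 fq2 qE cE [s0 [s1 cert]]; rewrite leqNgt; apply/negP => dn.
have fqh : frac_part q <= 1 / 2.
  apply: le_trans fq2 _; rewrite mul1r -exprVn -[leRHS]expr1.
  by apply: ler_wiXn2l => //; lra.
have [_ sos1 _ s1d _] := cert.
have := alt_sign_sum0 kn (leq_trans s1d dn).
rewrite (bigD1 (low_pt n k)) //= alt_sign_low mul1r.
move=> /eqP; rewrite addr_eq0 => /eqP low.
have low_ge : 2%:R ^+ n <= s1.@[cube_pt R (low_pt n k)].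
  apply: le_trans (multiplier_low fq0 qE cE cert (weight_low kn)).
  by rewrite -[leLHS]invrK lef_pV2 // posrE invr_gt0 exprn_gt0.
have : s1.@[cube_pt R (low_pt n k)] <= (2 ^ n - 1)%N%:R.
  rewrite low; apply: le_trans (ler_norm _) _; rewrite normrN.
  apply: le_trans (ler_norm_sum _ _ _) _.
  (* One unit for each cube point other than [low_pt n k]. *)
  have -> : (2 ^ n - 1)%N%:R
      = \sum_(f : {ffun 'I_n -> bool} | f != low_pt n k) (1 : R).
    rewrite sumr_const; congr (1 *+ _).
    by have := cardC1 (low_pt n k); rewrite card_ffun card_bool card_ord subn1.
  apply: ler_sum => f fx; rewrite normrM.
  have [->|/(alt_sign_neq0 kn fx) wf] := eqVneq (alt_sign R k f) 0.
    by rewrite normr0 mul0r.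
  rewrite mulr_ile1 ?alt_sign_norm_le1 // ger0_norm ?sos_ge0 //.
  exact: (multiplier_high qE cE cert).
move=> /(le_trans low_ge); rewrite -natrX ler_nat.
by have := expn_gt0 2 n; lia.
Qed.

Theorem corollary3p4 (R : realType) :
  exists c C : R, 0 < c /\ 0 < C /\
    forall (n : nat) (q : R),
      (1 <= n)%N ->
      0 < q -> q < (n./2)%:R ->
      frac_part q != 0 ->
      0 < frac_part q -> frac_part q <= 2%:R ^- n ->
      exists d : nat,
        MK_sos_rank n q d /\ c * n%:R <= d%:R /\ d%:R <= C * n%:R.
Proof.
(* From 2d >= n - k and k < n / 2 follows 4d >= n; the degree-n certificate gives the constant 1
   above. *)
exists (1 / 4), 1; split; first by lra.
split=> // n q n1 q0 qn _ fq0 fq2.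
have [k [qE cE]] := floor_split q0 fq0.
have kn : (k < n./2)%N by rewrite -(ltr_nat R); lra.
have certn := MK_has_certificate_n n q0 fq0.
(* Classical reflection makes the predicate boolean, as [ex_minnP] requires. *)
have exd : exists d, `[< MK_has_certificate n q d >].
  by exists n; exact/asboolP.
case: (ex_minnP exd) => d /asboolP certd dmin; exists d.
split; [split=> // d' /asboolP; exact: dmin | split].
  have := certificate_degree n1 _ fq0 fq2 qE cE certd.
  have -> : (k <= n)%N by lia.
  move=> /(_ isT) dk; have : (n <= 4 * d)%N by lia.
  by rewrite -(ler_nat R) natrM; lra.
by rewrite mul1r ler_nat dmin //; exact/asboolP.
Qed.
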